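(* Let $\mathbf{x}_1,\dots,\mathbf{x}_m\in\mathbb{R}^r$ be anchors such that the matrix $B=-\frac12 J_mDJ_m$ has rank $r$, let $\boldsymbol{\delta}=(\delta_1,\dots,\delta_m)^\top\in\mathbb{R}^m$, and let $\mathbf{a}_1,\dots,\mathbf{a}_m\in\mathbb{R}^r$, $\mathbf{b}=(b_1,\dots,b_m)^\top\in\mathbb{R}^m$, $b_0\in\mathbb{R}$, $P\in\mathbb{R}^{r\times r}$ and $\mathbf{x}_0\in\mathbb{R}^r$ be as defined in the context. Then the least-squares problem $$\min_{\mathbf{x}\in\mathbb{R}^r}\ f(\mathbf{x}):=\frac{1}{2m}\sum_{i=1}^m\Big(\|\mathbf{x}-\mathbf{x}_i\|^2-\delta_i\Big)^2$$ is equivalent to the problem $$\min_{\widetilde{\mathbf{x}}\in\mathbb{R}^r}\ g(\widetilde{\mathbf{x}}):=\frac12\big(\|\widetilde{\mathbf{x}}\|^2-b_0\big)^2+\frac{2}{m}\sum_{i=1}^m\big(\langle\mathbf{a}_i,\widetilde{\mathbf{x}}\rangle-b_i\big)^2,$$ in the sense that the two objectives coincide under the invertible change of variables $\mathbf{x}=P\widetilde{\mathbf{x}}+\mathbf{x}_0$, i.e. $f(P\widetilde{\mathbf{x}}+\mathbf{x}_0)=g(\widetilde{\mathbf{x}})$ for all $\widetilde{\mathbf{x}}\in\mathbb{R}^r$. Furthermore, if $\widetilde{\mathbf{x}}^*$ is an optimal solution of the second problem, then $\mathbf{x}^*=P\widetilde{\mathbf{x}}^*+\mathbf{x}_0$ is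 an optimal solution of the first problem.
   Context: Notation: $\|\cdot\|$ is the Euclidean norm, $\mathbf{1}_m$ the all-ones column vector of length $m$, $I_m$ the $m\times m$ identity, $J_m:=I_m-\frac1m\mathbf{1}_m\mathbf{1}_m^\top$. Let $D\in\mathbb{R}^{m\times m}$ be the matrix of squared anchor distances, $D_{ij}=\|\mathbf{x}_i-\mathbf{x}_j\|^2$, and $B:=-\frac12J_mDJ_m$, which is positive semidefinite and is assumed (standing assumption) to have rank $r$. Let $B=U_r\Lambda U_r^\top$ be a spectral decomposition, where $\Lambda=\mathrm{diag}(\lambda_1,\dots,\lambda_r)$ with $\lambda_1\ge\cdots\ge\lambda_r>0$ the positive eigenvalues of $B$, and the columns of $U_r\in\mathbb{R}^{m\times r}$ are corresponding orthonormal eigenvectors. The MDS coordinates of the anchors are the columns $\mathbf{a}_1,\dots,\mathbf{a}_m$ of $A:=\Lambda^{1/2}U_r^\top\in\mathbb{R}^{r\times m}$. Set $\boldsymbol{\delta}_0:=\frac1mD\mathbf{1}_m$, $\ \mathbf{b}:=\frac12J_m(\boldsymbol{\delta}_0-\boldsymbol{\delta})$, and $b_0:=\frac1m\mathbf{1}_m^\top\boldsymbol{\delta}-\frac{1}{2m^2}\mathbf{1}_m^\top D\mathbf{1}_m$. Set $\mathbf{x}_0:=\frac1m(\mathbf{x}_1+\cdots+\mathbf{x}_m)$, $\ \widetilde{X}:=[\mathbf{x}_1-\mathbf{x}_0,\dots,\mathbf{x}_m-\mathbf{x}_0]\in\mathbb{R}^{r\times m}$, let $A\widetilde{X}^\top=U\Sigma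 V^\top$ be a singular value decomposition with $U,V$ orthogonal $r\times r$ matrices and $\Sigma$ the diagonal matrix of singular values, and set $P:=VU^\top$. (It is known that $\mathbf{x}_i=P\mathbf{a}_i+\mathbf{x}_0$ for all $i$.) *)

(* Defs.v *)
From mathcomp Require Import all_boot all_order all_algebra.
From mathcomp Require Import reals.

Set Implicit Arguments.
Unset Strict Implicit.
Unset Printing Implicit Defensive.

Import Order.TTheory GRing.Theory Num.Theory.
Local Open Scope ring_scope.

Definition dotv (R : realType) (n : nat) (u v : 'cV[R]_n) : R :=
  \sum_(i < n) u i 0 * v i 0.

(* MathComp-Analysis equips matrices with the sup norm instead. *)
Definition enorm (R : realType) (n : nat) (u : 'cV[R]_n) : R :=
  Num.sqrt (dotv u u).

Definition ones (R : realType) (m : nat) : 'cV[R]_m := const_mx 1.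

Definition centering (R : realType) (m : nat) : 'M[R]_m :=
  1%:M - m%:R^-1 *: (ones R m *m (ones R m)^T).

Definition sqdist (R : realType) (r m : nat) (x : 'I_m -> 'cV[R]_r) : 'M[R]_m :=
  \matrix_(i, j) enorm (x i - x j) ^+ 2.

Definition gramB (R : realType) (r m : nat) (x : 'I_m -> 'cV[R]_r) : 'M[R]_m :=
  - (2^-1 *: (centering R m *m sqdist x *m centering R m)).

(* For a square matrix this says that Q is orthogonal. *)
Definition orthonormal_cols (R : realType) (m n : nat) (Q : 'M[R]_(m, n)) : Prop :=
  Q^T *m Q = 1%:M.

(* The last two conditions give B u_j = lam_j u_j for the columns u_j of Ur,
   and show that B vanishes on the orthogonal complement of their span, so that
   lam lists all the positive eigenvalues of B, with multiplicity. *)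
Definition spectral_decomposition (R : realType) (m r : nat)
    (B : 'M[R]_m) (Ur : 'M[R]_(m, r)) (lam : 'rV[R]_r) : Prop :=
  [/\ forall i : 'I_r, 0 < lam 0 i,
      forall i j : 'I_r, (i <= j)%N -> lam 0 j <= lam 0 i,
      orthonormal_cols Ur
    & B = Ur *m diag_mx lam *m Ur^T].

Definition singular_value_decomposition (R : realType) (r : nat)
    (M U : 'M[R]_r) (sigma : 'rV[R]_r) (V : 'M[R]_r) : Prop :=
  [/\ orthonormal_cols U, orthonormal_cols V,
      forall i : 'I_r, 0 <= sigma 0 i
    & M = U *m diag_mx sigma *m V^T].

Definition mds_coords (R : realType) (m r : nat)
    (Ur : 'M[R]_(m, r)) (lam : 'rV[R]_r) : 'M[R]_(r, m) :=
  diag_mx (map_mx Num.sqrt lam) *m Ur^T.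

Definition delta0 (R : realType) (r m : nat) (x : 'I_m -> 'cV[R]_r) : 'cV[R]_m :=
  m%:R^-1 *: (sqdist x *m ones R m).

Definition bvec (R : realType) (r m : nat) (x : 'I_m -> 'cV[R]_r)
    (delta : 'cV[R]_m) : 'cV[R]_m :=
  2^-1 *: (centering R m *m (delta0 x - delta)).

Definition bscal (R : realType) (r m : nat) (x : 'I_m -> 'cV[R]_r)
    (delta : 'cV[R]_m) : R :=
  m%:R^-1 * ((ones R m)^T *m delta) 0 0
  - (2 * m%:R ^+ 2)^-1 * ((ones R m)^T *m sqdist x *m ones R m) 0 0.

Definition centroid (R : realType) (r m : nat) (x : 'I_m -> 'cV[R]_r) : 'cV[R]_r :=
  m%:R^-1 *: \sum_(i < m) x i.

Definition centered (R : realType) (r m : nat) (x : 'I_m -> 'cV[R]_r) : 'M[R]_(r, m) :=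
  \matrix_(k < r, i < m) (x i - centroid x) k 0.

Definition ls_objective (R : realType) (r m : nat) (x : 'I_m -> 'cV[R]_r)
    (delta : 'cV[R]_m) (y : 'cV[R]_r) : R :=
  (2 * m%:R)^-1 * \sum_(i < m) (enorm (y - x i) ^+ 2 - delta i 0) ^+ 2.

Definition reduced_objective (R : realType) (r m : nat) (a : 'I_m -> 'cV[R]_r)
    (b : 'cV[R]_m) (b0 : R) (y : 'cV[R]_r) : R :=
  2^-1 * (enorm y ^+ 2 - b0) ^+ 2
  + 2 / m%:R * \sum_(i < m) (dotv (a i) y - b i 0) ^+ 2.

Definition optimal_solution (R : realType) (T : Type) (f : T -> R) (z : T) : Prop :=
  forall y : T, f z <= f y.

(* Main.v *)
Require Import Defs.
From mathcomp Require Import all_boot all_order all_algebra.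
From mathcomp Require Import reals.
From mathcomp Require Import ring.
Set Implicit Arguments.
Unset Strict Implicit.
Unset Printing Implicit Defensive.

Import Order.TTheory GRing.Theory Num.Theory.
Local Open Scope ring_scope.

(** With [X := centered x], double centering gives [B = X^T X], so [X^T X = A^T A]
    while [A A^T = Lambda].  Hence [(A X^T)(A X^T)^T = Lambda^2], and uniqueness
    of positive square roots identifies [U Sigma U^T] with [Lambda].  It follows that
    [tr (A^T P^T X) = tr Sigma = tr Lambda], so [tr ((P A - X)^T (P A - X)) = 0] and
    [P A = X].  Writing [N := |xt|^2], the [i]-th residual of [f] at [P xt + x0] is
    then [(N - b0) - 2 (<a_i, xt> - b_i)]; squaring and summing, the cross term
    vanishes because both the [a_i] and the [b_i] sum to zero. *)

(** * Euclidean inner product on column vectors *)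

Section EuclideanVectors.
Variables (R : realType) (n : nat).
Implicit Types u v : 'cV[R]_n.

Lemma dotvE u v : dotv u v = (u^T *m v) 0 0.
Proof. by rewrite mxE; apply: eq_bigr => i _; rewrite mxE. Qed.

Lemma dotvC u v : dotv u v = dotv v u.
Proof. by apply: eq_bigr => i _; rewrite mulrC. Qed.

Lemma dotv_suml (I : finType) (F : I -> 'cV[R]_n) v :
  \sum_i dotv (F i) v = dotv (\sum_i F i) v.
Proof.
rewrite exchange_big; apply: eq_bigr => k _.
by rewrite summxE mulr_suml.
Qed.

Lemma dotv0l v : dotv 0 v = 0.
Proof. by rewrite dotvE trmx0 mul0mx mxE. Qed.

Lemma enorm_sqr u : enorm u ^+ 2 = dotv u u.
Proof. by rewrite sqr_sqrtr // sumr_ge0 // => i _; rewrite -expr2 sqr_ge0. Qed.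

Lemma enorm_sqrB u v :
  enorm (u - v) ^+ 2 = enorm u ^+ 2 - 2 * dotv u v + enorm v ^+ 2.
Proof.
rewrite !enorm_sqr mulr_sumr -sumrB -big_split /=.
by apply: eq_bigr => i _; rewrite !mxE; ring.
Qed.

End EuclideanVectors.

(** * Gram matrices, square roots and orthogonal alignment *)

Section MatrixFacts.
Variable R : realType.

Lemma dotv_orthonormal_cols p n (Q : 'M[R]_(p, n)) (u v : 'cV[R]_n) :
  orthonormal_cols Q -> dotv (Q *m u) (Q *m v) = dotv u v.
Proof.
by move=> QQ; rewrite !dotvE trmx_mul mulmxA -(mulmxA _ _ Q) QQ mulmx1.
Qed.

(** The trace is the sum of the squares of all entries of [M]. Nonnegativity is used twice, first to
    isolate a column and then an entry. *)
Lemma mxtrace_gram_eq0 p n (M : 'M[R]_(p, n)) : \tr (M^T *m M) = 0 -> M = 0.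
Proof.
rewrite /mxtrace => tr0; apply/matrixP => i j; rewrite mxE.
have sq j' : (M^T *m M) j' j' = \sum_k M k j' ^+ 2.
  by rewrite mxE; apply: eq_bigr => k _; rewrite mxE.
have ge0 j' : 0 <= \sum_k M k j' ^+ 2 by apply: sumr_ge0 => k _; exact: sqr_ge0.
have col0 : \sum_k M k j ^+ 2 = 0.
  move: tr0; under eq_bigr => j' _ do rewrite sq.
  by move/(psumr_eq0P (fun j' _ => ge0 j')) => ->.
have /(_ i isT) /eqP := psumr_eq0P (fun k _ => sqr_ge0 (M k j)) col0.
by rewrite sqrf_eq0 => /eqP.
Qed.

Lemma orthonormal_cols_mulmxV n (Q : 'M[R]_n) :
  orthonormal_cols Q -> Q *m Q^T = 1%:M.
Proof. exact: mulmx1C. Qed.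

(** Entrywise, the hypothesis reads [lam_i^2 U_ij = U_ij sigma_j^2]. Where [U_ij] is nonzero,
    nonnegativity gives [lam_i = sigma_j], so [U] intertwines the roots as it does the squares. *)
Lemma nonneg_diag_sqrt_unique n (lam sigma : 'rV[R]_n) (U : 'M[R]_n) :
  (forall i, 0 <= lam 0 i) -> (forall i, 0 <= sigma 0 i) -> orthonormal_cols U ->
  diag_mx lam *m diag_mx lam = U *m (diag_mx sigma *m diag_mx sigma) *m U^T ->
  diag_mx lam = U *m diag_mx sigma *m U^T.
Proof.
move=> lam0 sig0 UU sqE.
suff LU : diag_mx lam *m U = U *m diag_mx sigma.
  by rewrite -LU -mulmxA orthonormal_cols_mulmxV // mulmx1.
have /matrixP LU2 : diag_mx lam *m (diag_mx lam *m U)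
    = U *m diag_mx sigma *m diag_mx sigma.
  by rewrite mulmxA sqE -!mulmxA UU mulmx1.
apply/matrixP => i j; have := LU2 i j.
rewrite !(mul_diag_mx, mul_mx_diag) !mxE => E.
have [->|Uij] := eqVneq (U i j) 0; first by rewrite mulr0 mul0r.
have : lam 0 i ^+ 2 = sigma 0 j ^+ 2.
  by apply: (mulIf Uij); rewrite !expr2 -mulrA E; ring.
by move/eqP; rewrite eqrXn2 // => /eqP ->; rewrite mulrC.
Qed.

(** An orthogonal Procrustes problem: equality of the Gram matrices makes the alignment of [A] with
    [X] exact. *)
Lemma polar_factor_gram r m (A X : 'M[R]_(r, m)) (lam sigma : 'rV[R]_r)
    (U V : 'M[R]_r) :
  (forall i, 0 <= lam 0 i) -> A *m A^T = diag_mx lam -> X^T *m X = A^T *m A ->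
  singular_value_decomposition (A *m X^T) U sigma V ->
  V *m U^T *m A = X.
Proof.
move=> lam0 AA XA [UU VV sig0 AX].
have XAt : X *m A^T = V *m diag_mx sigma *m U^T.
  by rewrite -[LHS]trmxK trmx_mul trmxK AX !trmx_mul trmxK tr_diag_mx mulmxA.
have lamE : diag_mx lam = U *m diag_mx sigma *m U^T.
  apply: nonneg_diag_sqrt_unique => //.
  (* Both sides equal [A X^T X A^T]: the left through [X^T X = A^T A], the right through the
     singular value decomposition. *)
  rewrite -AA mulmxA -(mulmxA A) -XA mulmxA AX -mulmxA XAt.
  by rewrite !mulmxA -(mulmxA _ V^T V) VV mulmx1.
set P := V *m U^T.
have PP : P^T *m P = 1%:M.
  by rewrite trmx_mul trmxK mulmxA -(mulmxA U) VV mulmx1 orthonormal_cols_mulmxV.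
have trAA : \tr (A^T *m A) = \tr (diag_mx lam) by rewrite mxtrace_mulC AA.
have trPX : \tr ((P *m A)^T *m X) = \tr (diag_mx lam).
  (* Cyclicity brings [P^T (X A^T)] under the trace, and this product is [U Sigma U^T]. *)
  rewrite trmx_mul -mulmxA mxtrace_mulC -mulmxA XAt trmx_mul trmxK.
  by rewrite !mulmxA -(mulmxA U) VV mulmx1 -lamE.
have trXP : \tr (X^T *m (P *m A)) = \tr (diag_mx lam).
  by rewrite -mxtrace_tr trmx_mul trmxK.
apply/subr0_eq/mxtrace_gram_eq0.
(* The four traces in the expansion all equal that of [diag_mx lam], with signs +, -, -, +. *)
rewrite [(_ - _)^T]raddfB /= mulmxBl !mulmxBr !raddfB /= trPX trXP XA trAA.
by rewrite trmx_mul mulmxA -(mulmxA _ _ P) PP mulmx1 trAA !subrr addr0.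
Qed.

Lemma mul_mds_coords_tr m r (Ur : 'M[R]_(m, r)) (lam : 'rV[R]_r) :
  (forall i, 0 <= lam 0 i) -> orthonormal_cols Ur ->
  mds_coords Ur lam *m (mds_coords Ur lam)^T = diag_mx lam.
Proof.
move=> lam0 UU; rewrite /mds_coords trmx_mul trmxK tr_diag_mx mulmxA.
rewrite -(mulmxA _ _ Ur) UU mulmx1 mulmx_diag; congr diag_mx.
by apply/rowP => i; rewrite !mxE -expr2 sqr_sqrtr.
Qed.

Lemma gram_mds_coords m r (Ur : 'M[R]_(m, r)) (lam : 'rV[R]_r) :
  (forall i, 0 <= lam 0 i) ->
  (mds_coords Ur lam)^T *m mds_coords Ur lam = Ur *m diag_mx lam *m Ur^T.
Proof.
move=> lam0; rewrite /mds_coords trmx_mul trmxK tr_diag_mx -!mulmxA.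
rewrite (mulmxA (diag_mx _)) mulmx_diag; congr (_ *m (diag_mx _ *m _)).
by apply/rowP => i; rewrite !mxE -expr2 sqr_sqrtr.
Qed.

End MatrixFacts.

(** * Double centering and the residuals of the objective *)

Section Centering.
Variables (R : realType) (r m : nat).
Hypothesis m_gt0 : (0 < m)%N.
Variables (x : 'I_m -> 'cV[R]_r) (delta : 'cV[R]_m).

Local Notation J := (centering R m).
Local Notation e := (ones R m).
Local Notation X := (centered x).
Local Notation mean v := (m%:R^-1 * \sum_j v j 0).

Let m_neq0 : m%:R != 0 :> R.
Proof. by rewrite pnatr_eq0 -lt0n. Qed.

Lemma tr_ones_mul (v : 'cV[R]_m) : (e^T *m v) = (\sum_j v j 0)%:M.
Proof.
apply/matrixP => i j; rewrite !ord1 !mxE.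
by apply: eq_bigr => k _; rewrite !mxE mul1r.
Qed.

Lemma centering_mul (v : 'cV[R]_m) : J *m v = v - mean v *: e.
Proof.
rewrite mulmxBl mul1mx -scalemxAl -mulmxA tr_ones_mul mul_mx_scalar.
by rewrite scalerA.
Qed.

Lemma tr_centering : J^T = J.
Proof. by rewrite linearB /= trmx1 linearZ /= trmx_mul trmxK. Qed.

Lemma centering_ones : J *m e = 0.
Proof.
rewrite centering_mul; under eq_bigr => j _ do rewrite mxE.
by rewrite sumr_const card_ord mulVf // scale1r subrr.
Qed.

Lemma sum_centering_mul (v : 'cV[R]_m) : \sum_i (J *m v) i 0 = 0.
Proof.
have : e^T *m (J *m v) = 0.
  by rewrite mulmxA -tr_centering -trmx_mul centering_ones trmx0 mul0mx.
by rewrite tr_ones_mul => /matrixP /(_ 0 0); rewrite !mxE.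
Qed.

Lemma col_centered i : col i X = x i - centroid x.
Proof. by apply/colP => k; rewrite !mxE. Qed.

Lemma sum_centered : \sum_i (x i - centroid x) = 0.
Proof.
rewrite sumrB sumr_const card_ord -scaler_nat scalerA divff //.
by rewrite scale1r subrr.
Qed.

Lemma centered_ones : X *m e = 0.
Proof.
apply/colP => k; rewrite -sum_centered summxE mxE.
by apply: eq_bigr => i _; rewrite !mxE mulr1.
Qed.

Lemma centered_centering : X *m J = X.
Proof.
by rewrite mulmxBr mulmx1 -scalemxAr mulmxA centered_ones mul0mx scaler0 subr0.
Qed.

Definition sqnorms : 'cV[R]_m := \col_i enorm (x i - centroid x) ^+ 2.
Local Notation s := sqnorms.

(** Distances are invariant under translation by the centroid, so each entry expands by the law of
    cosines. *)
Lemma sqdist_centered : sqdist x = s *m e^T + e *m s^T - 2 *: (X^T *m X).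
Proof.
apply/matrixP => i j.
have -> : sqdist x i j = s i 0 - 2 * dotv (col i X) (col j X) + s j 0.
  by rewrite !mxE !col_centered -enorm_sqrB opprB addrA subrK.
rewrite !mxE !big_ord1 !mxE mulr1 mul1r addrAC; congr (_ - 2 * _ + _).
by apply: eq_bigr => k _; rewrite !mxE.
Qed.

(** Since [J e = 0], centering on both sides kills the two terms containing [s]; the Gram term
    survives because [X J = X]. *)
Lemma gramB_centered : gramB x = X^T *m X.
Proof.
rewrite /gramB sqdist_centered (mulmxBr J) (mulmxBl (J *m _)) (mulmxDr J) mulmxDl.
have eJ : e^T *m J = 0 by rewrite -tr_centering -trmx_mul centering_ones trmx0.
rewrite (mulmxA J s) -(mulmxA (J *m s)) eJ mulmx0.
rewrite (mulmxA J e) centering_ones !mul0mx addr0 sub0r.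
rewrite -scalemxAr -scalemxAl scalerN opprK scalerA mulVf ?pnatr_eq0 // scale1r.
by rewrite mulmxA -{1}tr_centering -trmx_mul centered_centering -mulmxA
  centered_centering.
Qed.

Lemma sqdist_ones : sqdist x *m e = m%:R *: s + (\sum_j s j 0) *: e.
Proof.
rewrite sqdist_centered mulmxBl mulmxDl -!mulmxA.
rewrite -scalemxAl -mulmxA centered_ones mulmx0 scaler0 subr0 tr_ones_mul.
rewrite -[s^T *m e]trmxK trmx_mul trmxK tr_ones_mul tr_scalar_mx.
rewrite !mul_mx_scalar; under eq_bigr => j _ do rewrite mxE.
by rewrite sumr_const card_ord.
Qed.

(** The total of all squared distances is [2 m] times the sum of [s]. *)
Lemma bscalE : bscal x delta = mean delta - mean s.
Proof.
rewrite /bscal -mulmxA sqdist_ones mulmxDr -!scalemxAr !tr_ones_mul !mxE.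
under [\sum_j e _ _]eq_bigr => j _ do rewrite mxE.
by rewrite sumr_const card_ord !mulr1n; field.
Qed.

(** [J] removes the constant part of [delta0 x] and subtracts the mean of [s - delta], which is
    [- bscal x delta]. *)
Lemma bvecE i : 2 * bvec x delta i 0 = s i 0 - delta i 0 + bscal x delta.
Proof.
rewrite bscalE /bvec.
have -> : delta0 x = s + mean s *: e.
  by rewrite /delta0 sqdist_ones scalerDr !scalerA mulVf // scale1r.
rewrite addrAC mulmxDr -scalemxAr centering_ones scaler0 addr0.
have sumB : \sum_j (s - delta) j 0 = \sum_j s j 0 - \sum_j delta j 0.
  by rewrite -sumrB; apply: eq_bigr => j _; rewrite !mxE.
by rewrite centering_mul sumB !mxE; field.
Qed.

Lemma sum_bvec : \sum_i bvec x delta i 0 = 0.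
Proof.
under eq_bigr => i _ do rewrite mxE.
by rewrite -mulr_sumr sum_centering_mul mulr0.
Qed.

(** Stated for any orthogonal [P] that carries [A] to [X], which separates this computation from the
    construction of [P]. *)
Lemma ls_objective_isometry (A : 'M[R]_(r, m)) (P : 'M[R]_r) (y : 'cV[R]_r) :
  orthonormal_cols P -> P *m A = X ->
  ls_objective x delta (P *m y + centroid x)
  = reduced_objective (fun i => col i A) (bvec x delta) (bscal x delta) y.
Proof.
move=> PP PA; pose q i := dotv (col i A) y - bvec x delta i 0.
have Pcol i : x i - centroid x = P *m col i A.
  by rewrite -col_centered -PA colE -mulmxA -colE.
have residual i : enorm (P *m y + centroid x - x i) ^+ 2 - delta i 0
    = (enorm y ^+ 2 - bscal x delta) - 2 * q i.
  have -> : P *m y + centroid x - x i = P *m y - (x i - centroid x).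
    by rewrite opprB addrA addrAC.
  have sE : sqnorms i 0 = enorm (x i - centroid x) ^+ 2 by rewrite mxE.
  (* The isometry turns the cross term into [dotv (col i A) y], and [bvecE] replaces [s_i - delta_i]
     by [2 b_i - b0]. *)
  rewrite enorm_sqrB -sE Pcol !enorm_sqr !dotv_orthonormal_cols //.
  by rewrite (dotvC y (col i A)) /q (mulrBr 2 (dotv _ _)) bvecE; ring.
have sum_q : \sum_i q i = 0.
  rewrite sumrB sum_bvec subr0.
  (* Applying [P] to both arguments moves the sum to the centered anchors, which add up to zero. *)
  under eq_bigr => i _ do rewrite -(dotv_orthonormal_cols _ _ PP) -Pcol.
  by rewrite dotv_suml sum_centered dotv0l.
rewrite /ls_objective /reduced_objective.
under eq_bigr => i _ do rewrite residual sqrrB.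
set N := enorm y ^+ 2 - _.
rewrite big_split sumrB /= sumr_const card_ord.
have -> : \sum_i N * (2 * q i) *+ 2 = 0.
  by rewrite sumrMnl -mulr_sumr -mulr_sumr sum_q !mulr0 mul0rn.
under eq_bigr => i _ do rewrite exprMn.
by rewrite -mulr_sumr subr0 -mulr_natr; field.
Qed.

End Centering.

Theorem theorem1 (R : realType) (r m : nat) (m_gt0 : (0 < m)%N)
  (x : 'I_m -> 'cV[R]_r) (rankB : \rank (gramB x) = r)
  (delta : 'cV[R]_m)
  (Ur : 'M[R]_(m, r)) (lam : 'rV[R]_r)
  (specB : spectral_decomposition (gramB x) Ur lam)
  (U V : 'M[R]_r) (sigma : 'rV[R]_r)
  (svdAX : singular_value_decomposition
             (mds_coords Ur lam *m (centered x)^T) U sigma V) :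
  let a := fun i : 'I_m => col i (mds_coords Ur lam) in
  let b := bvec x delta in
  let b0 := bscal x delta in
  let P := V *m U^T in
  let x0 := centroid x in
  let f := ls_objective x delta in
  let g := reduced_objective a b b0 in
  [/\ bijective (fun xt : 'cV[R]_r => P *m xt + x0),
      forall xt : 'cV[R]_r, f (P *m xt + x0) = g xt
    & forall xt : 'cV[R]_r,
        optimal_solution g xt -> optimal_solution f (P *m xt + x0)].
Proof.
move=> a b b0 P x0 f g.
have [lam_gt0 _ UrUr BE] := specB.
have lam_ge0 i : 0 <= lam 0 i by apply: ltW.
have [UU VV _ _] := svdAX.
have PP : P^T *m P = 1%:M.
  by rewrite trmx_mul trmxK mulmxA -(mulmxA U) VV mulmx1 orthonormal_cols_mulmxV.
have PA : P *m mds_coords Ur lam = centered x.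
  apply: polar_factor_gram svdAX => //; first exact: mul_mds_coords_tr.
  by rewrite gram_mds_coords // -BE gramB_centered.
have fg xt : f (P *m xt + x0) = g xt by apply: ls_objective_isometry.
have hK : cancel (fun y : 'cV[R]_r => P^T *m (y - x0)) (fun xt => P *m xt + x0).
  by move=> y; rewrite mulmxA orthonormal_cols_mulmxV // mul1mx subrK.
split=> // [|xt opt y].
  by exists (fun y => P^T *m (y - x0)) => // xt; rewrite addrK mulmxA PP mul1mx.
(* Any competitor [y] is the image of [P^T (y - x0)], where the optimality of [xt] for [g]
   applies. *)
by rewrite -(hK y) !fg.
Qed.
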